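(* Let $n\ge 1$ and let $\rho_1,\dots,\rho_n$ be pairwise commuting projectors on the vector space $\mathcal{G}$ of two-player games. Then $\mathcal{G}$ is the direct sum of the following $2^n$ subspaces: $$\mathcal{G}=\bigoplus_{(\mathcal{C}_1,\dots,\mathcal{C}_n):\ \mathcal{C}_i\in\{K_{\rho_i},R_{\rho_i}\}}\ \bigcap_{i=1}^n\mathcal{C}_i,$$ where the sum is indexed by the $2^n$ choices, for each $i$, of either the kernel or the range of $\rho_i$.
   Context: $\mathcal{X}_1,\mathcal{X}_2$ are the pure strategy sets of the two players (probability spaces), and $\mathcal{G}$ is the real vector space of two-player games, i.e. of pairs $f=(f_1,f_2)$ of functions $f_j:\mathcal{X}_1\times\mathcal{X}_2\to\mathbb{R}$, where $f_j(x,y)$ is the payoff of player $j$ when the players play $x$ and $y$. A projector on $\mathcal{G}$ is a linear operator $\rho:\mathcal{G}\to\mathcal{G}$ with $\rho^2=\rho$. $K_\rho$ and $R_\rho$ denote the kernel and the range of $\rho$. *)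

(* Defs.v *)
From HB Require Import structures.
From mathcomp Require Import all_boot all_order all_algebra.
From mathcomp Require Import all_classical all_reals all_analysis.
Set Implicit Arguments.
Unset Strict Implicit.
Unset Printing Implicit Defensive.
Import GRing.Theory.
Local Open Scope classical_set_scope.
Local Open Scope ring_scope.

(* [R^o] rather than [R] makes payoff functions a vector space over [R]. *)
Definition game (R : realType) (X1 X2 : Type) : lmodType R :=
  ((X1 * X2 -> R^o) * (X1 * X2 -> R^o))%type.

Definition projector (R : realType) (V : lmodType R) (rho : {linear V -> V}) :=
  rho \o rho =1 rho.

Definition lin_kernel (R : realType) (V : lmodType R) (rho : {linear V -> V}) :
  set V := rho @^-1` [set 0].

(* Internal direct sum of a finite family of subspaces; the library's [directv]
   only covers finite-dimensional spaces. *)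
Definition is_direct_sum (R : realType) (V : lmodType R) (I : finType)
    (S : I -> set V) : Prop :=
  (forall i, submod_closed (mem (S i))) /\
  (forall v : V, exists! u : {ffun I -> V},
    (forall i, S i (u i)) /\ v = \sum_i u i).

(* Main.v *)
(* The two complementary projectors attached to [rho i] are [rho i] and
   [1 - rho i]. For each choice [c], compose the chosen ones into [J c]: by
   commutation [J c] is the identity on the summand of index [c] and vanishes on
   the others, which forces [u c = J c v] in any decomposition [v = \sum_c u c].
   Conversely [w = v - \sum_c J c v] is killed by every [J c], and removing the
   factors [rho i], [1 - rho i] of [J c] one index at a time gives [w = 0]. *)
Require Import Defs.
From HB Require Import structures.
From mathcomp Require Import all_boot all_order all_algebra.
From mathcomp Require Import all_classical all_reals all_analysis.
Set Implicit Arguments.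
Unset Strict Implicit.
Unset Printing Implicit Defensive.
Import GRing.Theory.
Local Open Scope classical_set_scope.
Local Open Scope ring_scope.

Section CommutingProjectors.
Variables (R : realType) (V : lmodType R).
Implicit Types (b : bool) (f g : {linear V -> V}).

Definition part b f : {linear V -> V} := if b then f else (idfun \- f).

Definition part_space b f : set V := if b then range f else lin_kernel f.

(** Idempotence turns both kernel and range into fixed-point sets: of [f] for the range, of [1 - f]
    for the kernel. The two cases can then be handled uniformly. *)
Lemma part_spaceP b f v :
  projector f -> part_space b f v <-> part b f v = v.
Proof.
move=> ff; case: b; rewrite /part_space /part /=.
  by split=> [[u _ <-]|<-]; [exact: ff | exists v].
split=> [/= ->|vf]; first by rewrite subr0.
by rewrite /lin_kernel /= -vf raddfB /= [f (f v)]ff subrr.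
Qed.

Lemma part_projector b f : projector f -> projector (part b f).
Proof.
move=> ff; case: b => // v; rewrite /= raddfB /=.
by rewrite [f (f v)]ff subrr subr0.
Qed.

Lemma part_comm b1 b2 f g :
  f \o g =1 g \o f -> part b1 f \o part b2 g =1 part b2 g \o part b1 f.
Proof.
move=> fg v; have {}fg : f (g v) = g (f v) := fg v.
case: b1 b2 => [] [] /=; rewrite ?linearB /= fg //.
by rewrite addrACA.
Qed.

Lemma partD b f v : part b f v + part (~~ b) f v = v.
Proof. by case: b => /=; rewrite ?subrK // addrC subrK. Qed.

Lemma part_space_submod b f :
  projector f -> submod_closed (mem (part_space b f)).
Proof.
move=> ff; split=> [|a u v]; rewrite !inE !part_spaceP ?raddf0 //.
by move=> uf vf; rewrite linearP uf vf.
Qed.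

Variables (I : finType) (rho : I -> {linear V -> V}).
Hypothesis rho_proj : forall i, projector (rho i).
Hypothesis rho_comm : forall i j, rho i \o rho j =1 rho j \o rho i.
Implicit Types (c : {ffun I -> bool}) (s : seq I).

(** The recursion is on a list so that [joint_part_eq0] can strip the indices one by one; the final
    use takes [s] to be [enum I]. *)
Definition joint_part c s : {linear V -> V} :=
  foldr (fun i f => part (c i) (rho i) \o f : {linear V -> V}) idfun s.

Lemma part_joint_part b i c s v :
  part b (rho i) (joint_part c s v) = joint_part c s (part b (rho i) v).
Proof.
elim: s => //= j s <-; exact: (part_comm b (c j) (rho_comm i j)).
Qed.

(** The outer factor commutes inward until it meets its own copy in the composite, where idempotence
    absorbs it. *)
Lemma joint_part_fixed c s i v :
  i \in s -> part (c i) (rho i) (joint_part c s v) = joint_part c s v.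
Proof.
elim: s => //= j s IHs; rewrite inE => /orP[/eqP <-|/IHs {}IHs].
  exact: part_projector.
by rewrite [LHS](part_comm (c i) (c j) (rho_comm i j)) /= IHs.
Qed.

Lemma joint_part_id c s v :
  (forall i, part (c i) (rho i) v = v) -> joint_part c s v = v.
Proof. by move=> cv; elim: s => //= i s ->. Qed.

(** A copy of the factor at [i] can be extracted and moved onto [v]. There it meets the
    complementary part of [rho i], and [f (1 - f) = (1 - f) f = 0]. *)
Lemma joint_part_neq c c' s i v : i \in s -> c i != c' i ->
  part (c' i) (rho i) v = v -> joint_part c s v = 0.
Proof.
move=> si cc' vi; rewrite -(joint_part_fixed c v si) part_joint_part -vi.
suff -> : part (c i) (rho i) (part (c' i) (rho i) v) = 0 by rewrite raddf0.
move: cc'; have rr : rho i (rho i v) = rho i v := rho_proj i v.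
by case: (c i) (c' i) => [] [] //= _; rewrite ?raddfB /= rr subrr.
Qed.

Lemma eq_joint_part c c' s :
  {in s, c =1 c'} -> joint_part c s =1 joint_part c' s.
Proof.
move=> + v; elim: s => //= i s IHs cc'.
by rewrite cc' ?mem_head // IHs // => j sj; rewrite cc' // inE sj orbT.
Qed.

Lemma joint_part_eq0 s v :
  uniq s -> (forall c, joint_part c s v = 0) -> v = 0.
Proof.
elim: s => [_ /(_ [ffun=> true]) //|i s IHs /= /andP[si us] v0].
apply: IHs => // c.
(* Both parts at [i] kill the tail composite, and they add up to the identity. Since [i] is not in
   [s], the choice at [i] can be reset to [b] without affecting the tail. *)
have part0 b : part b (rho i) (joint_part c s v) = 0.
  pose c' := [ffun j => if j == i then b else c j].
  have := v0 c'; rewrite /= ffunE eqxx => <-; congr (part _ _ _).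
  apply: eq_joint_part => j sj; rewrite ffunE ifN //.
  by apply: contraNneq si => <-.
by rewrite -(partD true (rho i) (joint_part c s v)) !part0 addr0.
Qed.

Lemma commuting_projectors_direct_sum :
  is_direct_sum (fun c => \bigcap_(i in [set: I]) part_space (c i) (rho i)).
Proof.
split=> [c|v].
  split=> [|a u v]; rewrite !inE.
    move=> i _; have [+ _] := part_space_submod (c i) (rho_proj i).
    by rewrite inE.
  move=> cu cv i _; have [_ /(_ a u v)] := part_space_submod (c i) (rho_proj i).
  by rewrite !inE; apply; [exact: cu | exact: cv].
have component c w : (\bigcap_(i in [set: I]) part_space (c i) (rho i)) w <->
    forall i, part (c i) (rho i) w = w.
  by split=> cw i *; apply/(part_spaceP _ _ (rho_proj i)); exact: cw.
(* Applied twice below: to the candidate [u] for existence, and to a competing [u'] for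
   uniqueness. *)
have joint_sum (u : {ffun {ffun I -> bool} -> V}) c :
    (forall c', (\bigcap_(i in [set: I]) part_space (c' i) (rho i)) (u c')) ->
    joint_part c (enum I) (\sum_c' u c') = u c.
  move=> uS; rewrite raddf_sum (bigD1 c) //= big1 ?addr0.
    by apply: joint_part_id; apply/component.
  (* A summand of another index vanishes at any [i] where the two choices differ. *)
  move=> c' c'c; have /existsP[i cc'] : [exists i, c i != c' i].
    apply: contraNT c'c; rewrite negb_exists => /forallP cc'.
    by apply/eqP/ffunP => i; apply/esym/eqP; rewrite -[_ == _]negbK.
  apply: (joint_part_neq (mem_enum I i) cc').
  by move/component: (uS c').
pose u := [ffun c => joint_part c (enum I) v].
have uS c : (\bigcap_(i in [set: I]) part_space (c i) (rho i)) (u c).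
  apply/component => i; rewrite ffunE.
  by apply: joint_part_fixed; rewrite mem_enum.
exists u; split=> [|u' [u'S vu']].
  split=> //; apply/eqP; rewrite -subr_eq0; apply/eqP.
  apply: (joint_part_eq0 (enum_uniq I)) => c.
  by rewrite raddfB /= joint_sum // ffunE subrr.
by apply/ffunP => c; rewrite ffunE vu' joint_sum.
Qed.

End CommutingProjectors.

Theorem theorem3p4 (R : realType) (d1 d2 : measure_display)
    (X1 : measurableType d1) (X2 : measurableType d2)
    (P1 : probability X1 R) (P2 : probability X2 R)
    (n : nat) (n_ge1 : (1 <= n)%N)
    (rho : 'I_n -> {linear game R X1 X2 -> game R X1 X2})
    (rho_proj : forall i, projector (rho i))
    (rho_comm : forall i j, rho i \o rho j =1 rho j \o rho i) :
  is_direct_sum (fun c : {ffun 'I_n -> bool} =>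
    \bigcap_(i in [set: 'I_n])
      (if c i then range (rho i) else lin_kernel (rho i))).
Proof. exact: commuting_projectors_direct_sum. Qed.
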